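(* (ZFC) For every almost disjoint family $\mathcal{A}\subseteq\wp(\mathbb{N})$ of cardinality $\mathfrak{c}$ there is $\phi:\mathcal{A}\to[0,2\pi)$ such that the Akemann–Doner algebra $AD(\mathcal{A},\phi)$ (which has density $\mathfrak{c}$) has no commutative C*-subalgebra of density $\mathfrak{c}$.
   Context: $\mathfrak{c}=|\mathbb{R}|$. An almost disjoint family is an infinite family of infinite subsets of $\mathbb{N}$ with pairwise finite intersections. $M_2$ is the C*-algebra of complex $2\times2$ matrices with the operator norm; $\ell_\infty(M_2)$ is the C*-algebra of norm-bounded sequences in $M_2$ with coordinatewise operations and supremum norm; $c_0(M_2)$ is its subalgebra of sequences whose norms tend to $0$. For $\theta\in[0,2\pi)$ let $p_\theta=\begin{bmatrix}\sin^2\theta&\sin\theta\cos\theta\\ \sin\theta\cos\theta&\cos^2\theta\end{bmatrix}$, and for $A\subseteq\mathbb{N}$ let $P_{A,\theta}(n)=p_\theta$ for $n\in A$ and $0$ otherwise. $AD(\mathcal{A},\phi)$ is the C*-subalgebra of $\ell_\infty(M_2)$ generated by $c_0(M_2)$ and $\{P_{A,\phi(A)}\mid A\in\mathcal{A}\}$. The density of a C*-algebra is the minimal cardinality of a norm-dense subset. *)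

(* Defs.v *)
From HB Require Import structures.
From mathcomp Require Import all_boot all_order all_algebra.
From mathcomp Require Import sesquilinear spectral.
From mathcomp Require Import all_classical all_reals all_analysis.
From mathcomp Require Export complex.

Set Implicit Arguments.
Unset Strict Implicit.
Unset Printing Implicit Defensive.
Import Order.TTheory GRing.Theory Num.Theory.
Import numFieldNormedType.Exports.
Local Open Scope classical_set_scope.
Local Open Scope ring_scope.
Local Open Scope card_scope.
Local Open Scope sesquilinear_scope.

Definition almost_disjoint (F : set (set nat)) : Prop :=
  [/\ infinite_set F,
      forall A, F A -> infinite_set A
    & forall A B, F A -> F B -> A <> B -> finite_set (A `&` B)].

Section AkemannDoner.
Variable R : realType.

(* Sequences carry the pointwise ring and R[i]-module structures of
   mathcomp.classical.functions. *)
Definition mseq : Type := nat -> 'M[R[i]]_2.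

Definition eucl_norm (v : 'cV[R[i]]_2) : R :=
  Num.sqrt (\sum_(i < 2) ComplexField.Normc.normc (v i 0) ^+ 2).

Definition op_norm (M : 'M[R[i]]_2) : R :=
  sup [set eucl_norm (M *m v) | v in [set v | eucl_norm v <= 1]].

Definition linfty : set mseq :=
  [set x | exists b : R, forall n, op_norm (x n) <= b].

(* Meaningful on linfty only: sup is 0 on sets that are not bounded above. *)
Definition sup_norm (x : mseq) : R := sup (range (fun n => op_norm (x n))).

Definition c0 : set mseq := [set x | op_norm (x n) @[n --> \oo] --> (0 : R)].

Definition adjoint (x : mseq) : mseq := fun n => x n ^t*.

(* Not necessarily unital. *)
Record cstar_subalgebra (B : set mseq) : Prop := CstarSubalgebra {
  cstar_linfty : B `<=` linfty;
  cstar_0 : B (0 : mseq);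
  cstar_add : forall x y : mseq, B x -> B y -> B (x + y);
  cstar_scale : forall (a : R[i]) (x : mseq), B x -> B (a *: x);
  cstar_mul : forall x y : mseq, B x -> B y -> B (x * y);
  cstar_adjoint : forall x : mseq, B x -> B (adjoint x);
  cstar_closed : forall x : mseq, linfty x ->
    (forall e : R, 0 < e -> exists2 y : mseq, B y & sup_norm (x - y) < e) ->
    B x
}.

Definition cstar_generated (G : set mseq) : set mseq :=
  smallest cstar_subalgebra G.

Definition commutative_set (B : set mseq) : Prop :=
  forall x y : mseq, B x -> B y -> x * y = y * x.

Definition norm_dense_in (D B : set mseq) : Prop :=
  D `<=` B /\
  forall x : mseq, B x -> forall e : R, 0 < e ->
    exists2 y : mseq, D y & sup_norm (x - y) < e.

(* The minimal cardinality of a norm-dense subset of B is that of K. *)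
Definition has_density T (B : set mseq) (K : set T) : Prop :=
  (exists D : set mseq, norm_dense_in D B /\ D #= K) /\
  (forall D : set mseq, norm_dense_in D B -> K #<= D).

Definition proj_angle (t : R) : 'M[R[i]]_2 :=
  \matrix_(i < 2, j < 2)
    ((nth 0 (nth [::] [:: [:: sin t ^+ 2;    sin t * cos t];
                          [:: sin t * cos t; cos t ^+ 2   ]] i) j)%:C)%C.

Definition proj_seq (A : set nat) (t : R) : mseq :=
  fun n => if n \in A then proj_angle t else 0.

(* Only the values of phi on F matter. *)
Definition AD (F : set (set nat)) (phi : set nat -> R) : set mseq :=
  cstar_generated (c0 `|` [set proj_seq A (phi A) | A in F]).

End AkemannDoner.

(* Main.v *)
Require Import Defs.
From HB Require Import structures.
From mathcomp Require Import all_boot all_order all_algebra.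
From mathcomp Require Import sesquilinear.
From mathcomp Require Import all_classical all_reals all_analysis.
From mathcomp Require Import ring lra.
From mathcomp Require wochoice.

(* Modulo c0, an element u of the algebra is, on each A in the family, a
   multiple of the projection p_(phi A), and it vanishes off finitely many A.
   If B is commutative, choose at each n a non-scalar value m n of an element
   of B, if there is one.  Every b n commutes with m n, and the commutant of a
   non-scalar 2x2 matrix is commutative; since p_s and p_t do not commute for
   s <> t in [0, pi/2[, the sequence m determines phi A for each A on which
   some element of B does not tend to 0.  There are only continuum many
   sequences m, so, well-ordering them together with the family, one can choose
   phi A different from the fewer than continuum many angles determined on A by
   the earlier m.  For a given B this leaves fewer than continuum many A on
   which B is not null, hence a dense subset of B of size less than the
   continuum.

   Cardinal arithmetic is avoided by calling a set S small when the reals do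
   not inject into the finite words over S + nat: this notion is stable under
   passing to words of words, and a total order on the reals with small initial
   segments exists. *)

Set Implicit Arguments.
Unset Strict Implicit.
Unset Printing Implicit Defensive.
Import Order.TTheory GRing.Theory Num.Theory.
Import numFieldNormedType.Exports.
Local Open Scope classical_set_scope.
Local Open Scope ring_scope.
Local Open Scope card_scope.

(** * Words over a set *)

Section Words.
Variable T : choiceType.
Implicit Types (S : set T) (x y : T).

(** For uncountable [T] this says that [T] has cardinality at most that of [S]. The letters from
    [nat] absorb countable data, and keeping all words in one type, with a side condition on
    letters, lets codings be composed. *)
Definition word_large S : Prop :=
  exists2 h : T -> seq (T + nat),
    injective h & forall x y, inl y \in h x -> S y.

Lemma word_largeS S S' : S `<=` S' -> word_large S -> word_large S'.
Proof. by move=> SS' [h hi hS]; exists h => // x y /hS /SS'. Qed.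

Lemma word_large_setT : word_large setT.
Proof. by exists (fun x => [:: inl x]) => // x y []. Qed.

Lemma word_large_inj S (k : T -> T) : injective k -> (forall x, S (k x)) ->
  word_large S.
Proof.
move=> ki kS; exists (fun x => [:: inl (k x)]) => [x y [/ki]//|x y].
by rewrite inE => /eqP[->].
Qed.

(* A word of words is coded by its concatenation and the list of lengths. *)
Lemma word_large_trans S S' (h g : T -> seq (T + nat)) :
  injective h -> injective g ->
  (forall x y, inl y \in h x -> S y) ->
  (forall x y, S x -> inl y \in g x -> S' y) -> word_large S'.
Proof.
move=> hi gi hS gS'.
(* The head [inr 0] tells the code of an element of [T] from that of a natural number, which is
   shifted by one. *)
pose l (u : T + nat) : seq (T + nat) :=
  match u with inl x => inr 0%N :: g x | inr n => [:: inr n.+1] end.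
have li : injective l.
  by case=> [x|n] [y|m] //= [] => [/gi|] ->.
pose L x := map l (h x).
exists (fun x => inr (pickle (shape (L x))) :: flatten (L x)).
  move=> x y [/(pcan_inj pickleK) sh fl].
  by apply/hi/(inj_map li); rewrite -[LHS]flattenK -[RHS]flattenK sh fl.
move=> x y; rewrite inE /= => /flattenP[_ /mapP[[z|n] zh ->]].
  by rewrite inE /=; apply/gS'/hS/zh.
by rewrite inE.
Qed.

(** Shifting the naturals by one frees the letter [inr 0], which then stands for [x0]. *)
Lemma word_large_setU1 S x0 : word_large (S `|` [set x0]) -> word_large S.
Proof.
move=> [h hi hS].
pose l (u : T + nat) : T + nat :=
  match u with inl x => if x == x0 then inr 0%N else inl x | inr n => inr n.+1 end.
have li : injective l.
  case=> [x|n] [y|m] //=; last by case=> ->.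
  - by case: (eqVneq x x0) => [->|_]; case: (eqVneq y x0) => [->|_] // [->].
  - by case: ifP.
  - by case: ifP.
exists (map l \o h) => [x y /(inj_map li)/hi//|x y /mapP[[z|n] zh //=]].
by case: eqP => // zx [->]; case: (hS _ _ zh).
Qed.

(** In a well-order [W], cut at the first large segment, if there is one: this gives a large [U] all
    of whose elements have small segments. Elements of [T], coded by words over [U], are compared
    through the [W]-largest letter of their codes. *)
Lemma word_large_segments : ~ word_large set0 ->
  exists le : T -> T -> Prop,
    (forall x y, le x y \/ le y x) /\
    forall y, ~ word_large [set x | le x y].
Proof.
move=> small0; have [W Wwo] := wochoice.well_ordering_principle T.
have Wmin (A : set T) : A !=set0 ->
    exists2 z, A z & forall x, A x -> W z x.
  move=> [x Ax]; have [|z [[zA zl] _]] := Wwo (mem A).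
    by exists x; rewrite inE.
  by exists z => [|y Ay]; [rewrite inE in zA | apply: zl; rewrite inE].
have Wtot x y : W x y \/ W y x.
  have [|z [->|->] zl] := Wmin [set x; y]; first by exists x; left.
  - by left; apply: zl; right.
  - by right; apply: zl; left.
have Wanti : antisymmetric W.
  move=> x y /andP[xy yx].
  have [|z [_ zu]] := Wwo (mem [set x; y]); first by exists x; rewrite inE; left.
  have Wxx u : W u u by have [] := Wtot u u.
  rewrite -(zu x) ?(zu y) //; split; rewrite ?inE; do ?[by left|by right].
    by move=> u; rewrite inE => -[] ->.
  by move=> u; rewrite inE => -[] ->.
have Wtr x y z : W x y -> W y z -> W x z.
  move=> xy yz; have [|t tE tl] := Wmin [set x; y; z].
    by exists x; left; left.
  have [[tx|ty]|tz] := tE.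
  - by rewrite -tx; apply: tl; right.
  - have : W y x by rewrite -ty; apply: tl; left; left.
    by move=> yx; rewrite (Wanti x y) // xy.
  - have Wzx : W z x by rewrite -tz; apply: tl; left; left.
    have Wzy : W z y by rewrite -tz; apply: tl; left; right.
    have <- : y = z by apply: Wanti; rewrite yz.
    exact: xy.
pose seg y : set T := [set x | W x y].
have [U [h hi hU] Usmall] : exists2 U : set T, word_large U &
    forall y, U y -> ~ word_large (seg y).
  have [[v0 v0P]|allsmall] := pselect (exists v, word_large (seg v)).
    have [|v vP vmin] := Wmin [set v | word_large (seg v)]; first by exists v0.
    exists [set x | W x v /\ x <> v].
      apply: (word_large_setU1 (x0 := v)); apply: word_largeS vP => x xv.
      by have [->|xnv] := pselect (x = v); [right | left].
    move=> y [yv ynv] /vmin vy; apply: ynv; apply: Wanti; by rewrite yv vy.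
  exists setT; first exact: word_large_setT.
  by move=> y _ ylarge; apply: allsmall; exists y.
exists (fun x y => forall u, inl u \in h x -> exists2 v, inl v \in h y & W u v).
split.
  move=> x y; have [|H] := pselect (forall u, inl u \in h x ->
      exists2 v, inl v \in h y & W u v); [by left | right].
  move=> v vy; apply: contrapT => nv; apply: H => u ux.
  exists v => //; have [//|vu] := Wtot u v.
  by exfalso; apply: nv; exists u.
move=> y ylarge.
(* If [x] is below [y], every letter of [h x] is below a letter of [h y], so recoding by [h] moves
   largeness to this set of letters. The induction on [h y] then bounds it by the segment of the
   largest letter, or by the empty set. *)
have {ylarge} : word_large [set u | exists2 v, inl v \in h y & W u v].
  have [k ki kS] := ylarge.
  by apply: (word_large_trans ki hi kS) => x u; apply.
have : forall v, inl v \in h y -> U v by move=> v /hU.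
elim: (h y) => [_|[v|n] l IH lU].
- by apply: contra_not small0; apply: word_largeS => u [].
- have {}IH := IH (fun w wl => lU w (mem_behead (s := _ :: _) wl)).
  have [[w wl vw]|nvw] := pselect (exists2 w, inl w \in l & W v w).
    apply: contra_not IH; apply: word_largeS => u [z].
    rewrite inE => /orP[/eqP[->]|zl] uz; last by exists z.
    by exists w => //; apply: Wtr uz vw.
  have /Usmall : U v by apply: lU; rewrite mem_head.
  apply: contra_not; apply: word_largeS => u [z].
  rewrite inE => /orP[/eqP[->]//|zl] uz.
  have [vz|zv] := Wtot v z; first by exfalso; apply: nvw; exists z.
  exact: Wtr uz zv.
- have {}IH := IH (fun w wl => lU w (mem_behead (s := _ :: _) wl)).
  apply: contra_not IH; apply: word_largeS => u [z].
  by rewrite inE => /orP[//|zl] uz; exists z.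
Qed.

End Words.

(** * Codings by real numbers *)

Section Continuum.
Variable R : realType.

Definition ternary_sum (b : nat -> bool) (n : nat) : R :=
  \sum_(i < n) (b i)%:R * 3 ^- i.

Lemma ternary_sumS b n : ternary_sum b n.+1 = ternary_sum b n + (b n)%:R * 3 ^- n.
Proof. by rewrite /ternary_sum big_ord_recr. Qed.

(** The added term is the geometric sum of [3 ^- i] over [k <= i < k + j]. *)
Lemma ternary_sum_tail b k j :
  ternary_sum b (k + j) <= ternary_sum b k + 3 / 2 * (3 ^- k - 3 ^- (k + j)).
Proof.
elim: j => [|j IH]; first by rewrite addn0 subrr mulr0 addr0.
rewrite addnS ternary_sumS exprS invfM.
have : 0 < 3 ^- (k + j) :> R by rewrite invr_gt0 exprn_gt0.
move: IH; set t := 3 ^- (k + j); move: (ternary_sum _ _) (ternary_sum _ _) => x y.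
by case: (b _); rewrite /= => IH t0; lra.
Qed.

Lemma ternary_sum_le b k n : (k <= n)%N -> ternary_sum b k <= ternary_sum b n.
Proof.
move=> /subnKC <-; elim: (n - k)%N => [|j IH]; first by rewrite addn0.
rewrite addnS ternary_sumS (le_trans IH)// lerDl mulr_ge0 ?ler0n//.
Qed.

Lemma ternary_sum_bound b k n :
  ternary_sum b n <= ternary_sum b k + 3 / 2 * 3 ^- k.
Proof.
have t0 : 0 <= 3 ^- k :> R by rewrite invr_ge0 exprn_ge0.
have [nk|kn] := leqP n k.
  by rewrite (le_trans (ternary_sum_le b nk))// lerDl mulr_ge0// divr_ge0.
rewrite -(subnKC (ltnW kn)) (le_trans (ternary_sum_tail _ _ _))//.
by rewrite lerD2l ler_wpM2l ?divr_ge0// gerBl invr_ge0 exprn_ge0.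
Qed.

Lemma bool_seq_inj_real : exists f : (nat -> bool) -> R, injective f.
Proof.
pose f b := sup (range (ternary_sum b)).
have ub b k : ubound (range (ternary_sum b)) (ternary_sum b k + 3 / 2 * 3 ^- k).
  by move=> _ [n _ <-]; exact: ternary_sum_bound.
have f_le b k : f b <= ternary_sum b k + 3 / 2 * 3 ^- k.
  by apply: ge_sup (ub b k); exists (ternary_sum b 0); exists 0%N.
have f_ge b k : ternary_sum b k <= f b.
  apply: ub_le_sup; last by exists k.
  by exists (ternary_sum b 0 + 3 / 2 * 3 ^- 0); exact: ub.
(* Base 3 makes the first differing digit decisive: it contributes [3 ^- k], while all later digits
   together contribute at most half of that. *)
have lt (b c : nat -> bool) k : (forall i, (i < k)%N -> b i = c i) -> b k -> ~~ c k -> f c < f b.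
  move=> bc bk ck; apply: (le_lt_trans (f_le c k.+1)).
  apply: (lt_le_trans _ (f_ge b k.+1)); rewrite !ternary_sumS bk (negbTE ck).
  have -> : ternary_sum b k = ternary_sum c k.
    by apply: eq_bigr => i _; rewrite bc.
  rewrite exprS invfM; have : 0 < 3 ^- k :> R by rewrite invr_gt0 exprn_gt0.
  by move: (3 ^- k) (ternary_sum _ _) => t x /= t0; lra.
exists f => b c fbc; apply/funext; apply: contrapT => /existsNP[n nbc].
have ex : exists n, b n != c n by exists n; apply/eqP.
case: (ex_minnP ex) => {nbc}k kbc kmin.
have kbc' i : (i < k)%N -> b i = c i.
  by move=> ik; apply/eqP; apply: contraTT ik; rewrite -leqNgt; exact: kmin.
case bk : (b k); case ck : (c k); rewrite ?bk ?ck// in kbc.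
- by have := lt b c k kbc' bk; rewrite ck fbc ltxx => /(_ isT).
- have := lt c b k _ ck; rewrite bk fbc ltxx => H; suff: false by [].
  by apply: H => // i /kbc'.
Qed.

(** Words without real letters are lists of naturals, hence countably many, whereas the reals
    contain a copy of the Cantor space. *)
Lemma real_words_small : ~ word_large (set0 : set R).
Proof.
move=> [h hi h0]; have [f fi] := bool_seq_inj_real.
pose l (u : R + nat) : nat := if u is inr n then n else 0%N.
pose g b := pickle (map l (h (f b))).
have gi : injective g.
  move=> b c /(pcan_inj pickleK) bc; apply/fi/hi.
  have red x : h x = map inr (map l (h x)).
    rewrite -map_comp -[LHS]map_id; apply/eq_in_map => -[y|//].
    by move=> /h0.
  by rewrite red bc -red.
(* Cantor's diagonal sequence for the injection [g] into [nat]. *)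
pose d n := `[< exists2 b, g b = n & b n = false >].
have [dd|dd] := boolP (d (g d)).
  by have /asboolP[b /gi -> ddF] := dd; rewrite ddF in dd.
by move/asboolP: (dd); apply; exists d => //; apply/negbTE.
Qed.

(** A sequence is determined by the rational cuts of the real and imaginary parts of its entries,
    which amount to countably many bits. *)
Lemma mseq_inj_real : exists e : mseq R -> R, injective e.
Proof.
have [f fi] := bool_seq_inj_real.
pose part (c : bool) (z : R[i]) := if c then complex.Re z else complex.Im z.
pose bits (x : mseq R) (k : nat) : bool :=
  match (unpickle k : option (nat * 'I_2 * 'I_2 * bool * rat)) with
  | Some (n, i, j, c, q) => ratr q < part c (x n i j)
  | None => false
  end.
exists (f \o bits) => x y /fi xy; apply/funext => n; apply/matrixP => i j.
have P c : part c (x n i j) = part c (y n i j).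
  have cut q : (ratr q < part c (x n i j)) = (ratr q < part c (y n i j)).
    by have := congr1 (fun b => b (pickle (n, i, j, c, q))) xy; rewrite /bits pickleK.
  case: (ltgtP (part c (x n i j)) (part c (y n i j))) => // /rat_in_itvoo[q];
    by rewrite in_itv /= => /andP[q1 q2]; have := cut q;
       rewrite q2 ?q1 ltNge ?(ltW q1).
by have := P true; have := P false; move: (x n i j) (y n i j) => [a b] [c d] /= -> ->.
Qed.

Lemma real_inj_quarter : exists2 f : R -> R, injective f &
  forall x, 0 <= f x < pi / 2.
Proof.
exists (fun x => (atan x + pi / 2) / 2).
  move=> x y /(mulIf _) H; have {}H : atan x + pi / 2 = atan y + pi / 2.
    by apply: H; rewrite invr_neq0.
  by rewrite -[x]atanK -[y]atanK; move/addIr: H => ->.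
by move=> x; have := atan_gtNpi2 x; have := atan_ltpi2 x; move: (atan x) => t; lra.
Qed.

Lemma card_le_realP (D : set (mseq R)) : [set: R] #<= D ->
  exists2 f : R -> mseq R, injective f & forall x, D (f x).
Proof.
move=> /card_leP[f]; pose i (x : R) : [set: R] := SigSub (mem_set (I : setT x)).
exists (fun x => val (f (i x))); last by move=> x; exact: set_valP.
by move=> x y /val_inj/(inj (mem_set I) (mem_set I))/(congr1 val).
Qed.

Lemma inj_card_le_real T U (A : set T) (D : set U) (f : T -> U) :
  (forall x, A x -> D (f x)) -> {in A &, injective f} -> A #<= D.
Proof.
move=> fD fi; apply: (card_le_trans (B := f @` A)).
  by have := inj_card_eq fi; rewrite card_eq_le => /andP[].
by apply: subset_card_le => _ [x Ax <-]; exact: fD.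
Qed.

End Continuum.

(** * Norms *)

Section Norms.
Local Open Scope sesquilinear_scope.
Variable R : realType.
Local Notation C := R[i].
Local Notation normc := ComplexField.Normc.normc.
Local Notation M2 := 'M[C]_2.
Implicit Types (x y z : M2) (a : C).

Lemma normc_ge0 a : 0 <= normc a :> R.
Proof. by case: a => u v; rewrite /= sqrtr_ge0. Qed.

Lemma normc0 : normc (0 : C) = 0 :> R.
Proof. exact: ComplexField.Normc.normc0. Qed.

Lemma normcN a : normc (- a) = normc a :> R.
Proof. exact: normcN. Qed.

Lemma normc_conj a : normc (a^*) = normc a :> R.
Proof. by apply: complexI; have := norm_conjC a. Qed.

Lemma ord2E (i : 'I_2) : i = 0 \/ i = 1.
Proof. by case: i => -[|[|//]] p; [left | right]; apply: val_inj. Qed.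

Lemma sum_ord2 (V : nmodType) (f : 'I_2 -> V) : \sum_(i < 2) f i = f 0 + f 1.
Proof.
by rewrite !big_ord_recl big_ord0 addr0; congr (f _ + f _); apply: val_inj.
Qed.

Lemma mulmx2E m (x : M2) (y : 'M[C]_(2, m)) i j :
  (x *m y) i j = x i 0 * y 0 j + x i 1 * y 1 j.
Proof. by rewrite mxE sum_ord2. Qed.

(** This submultiplicative norm lies between [op_norm] and [4 * op_norm]; all estimates are made
    with it, which accounts for the factors 4 wherever [sup_norm] is involved. *)
Definition entry_norm x : R :=
  normc (x 0 0) + normc (x 0 1) + normc (x 1 0) + normc (x 1 1).

Lemma entry_norm_ge0 x : 0 <= entry_norm x.
Proof. by rewrite /entry_norm !addr_ge0 ?normc_ge0. Qed.

Lemma entry_norm0 : entry_norm 0 = 0.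
Proof. by rewrite /entry_norm !mxE !normc0 !addr0. Qed.

Lemma entry_normN x : entry_norm (- x) = entry_norm x.
Proof. by rewrite /entry_norm !mxE !normcN. Qed.

Lemma entry_normD x y : entry_norm (x + y) <= entry_norm x + entry_norm y.
Proof.
rewrite /entry_norm !mxE.
have := @le_normcD R (x 0 0) (y 0 0); have := @le_normcD R (x 0 1) (y 0 1).
have := @le_normcD R (x 1 0) (y 1 0); have := @le_normcD R (x 1 1) (y 1 1).
lra.
Qed.

Lemma entry_normB x y : entry_norm (x - y) <= entry_norm x + entry_norm y.
Proof. by rewrite -(entry_normN y) entry_normD. Qed.

Lemma entry_normC x y : entry_norm (x - y) = entry_norm (y - x).
Proof. by rewrite -entry_normN opprB. Qed.

Lemma entry_normDB z x y :
  entry_norm (x - y) <= entry_norm (x - z) + entry_norm (z - y).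
Proof. by rewrite -[x - y](subrKA z) entry_normD. Qed.

Lemma entry_normZ a x : entry_norm (a *: x) = normc a * entry_norm x.
Proof.
by rewrite /entry_norm !mxE !ComplexField.Normc.normcM !mulrDr.
Qed.

Lemma entry_norm_ge x i j : normc (x i j) <= entry_norm x.
Proof.
have := normc_ge0 (x 0 0); have := normc_ge0 (x 0 1).
have := normc_ge0 (x 1 0); have := normc_ge0 (x 1 1); rewrite /entry_norm.
by case: (ord2E i) => ->; case: (ord2E j) => ->; lra.
Qed.

Lemma entry_normM x y : entry_norm (x * y) <= entry_norm x * entry_norm y.
Proof.
have P i j : normc ((x * y) i j) <=
    normc (x i 0) * normc (y 0 j) + normc (x i 1) * normc (y 1 j).
  by rewrite mulmx2E (le_trans (le_normcD _ _))// !ComplexField.Normc.normcM.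
have := P 0 0; have := P 0 1; have := P 1 0; have := P 1 1.
rewrite /entry_norm.
have nn u v i j : 0 <= normc (x u v) * normc (y i j).
  by rewrite mulr_ge0 ?normc_ge0.
have := nn 0 0 1 0; have := nn 0 0 1 1; have := nn 0 1 0 0; have := nn 0 1 0 1.
have := nn 1 0 1 0; have := nn 1 0 1 1; have := nn 1 1 0 0; have := nn 1 1 0 1.
lra.
Qed.

Lemma entry_norm_adj x : entry_norm (x ^t*) = entry_norm x.
Proof. by rewrite /entry_norm !mxE !normc_conj; ring. Qed.

Lemma op_normP x (v : 'cV[C]_2) : eucl_norm v <= 1 ->
  eucl_norm (x *m v) <= entry_norm x.
Proof.
have sqr_le (s t : R) : 0 <= s -> 0 <= t -> Num.sqrt (s ^+ 2 + t ^+ 2) <= s + t.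
  move=> s0 t0; rewrite -[leRHS]ger0_norm ?addr_ge0// -sqrtr_sqr.
  by rewrite ler_wsqrtr// sqrrD lerD2r lerDl mulrn_wge0// mulr_ge0.
have le_sqr (s t : R) : s <= Num.sqrt (s ^+ 2 + t ^+ 2).
  by rewrite (le_trans (ler_norm _))// -sqrtr_sqr ler_wsqrtr// lerDl sqr_ge0.
rewrite /eucl_norm !sum_ord2 => v1.
have v01 : normc (v 0 0) <= 1 by apply: le_trans v1; exact: le_sqr.
have v11 : normc (v 1 0) <= 1.
  by apply: le_trans v1; rewrite addrC; exact: le_sqr.
apply: (le_trans (sqr_le _ _ (normc_ge0 _) (normc_ge0 _))).
have P i : normc ((x *m v) i 0) <= normc (x i 0) + normc (x i 1).
  rewrite mulmx2E (le_trans (le_normcD _ _))// !ComplexField.Normc.normcM.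
  by rewrite lerD// ler_piMr// normc_ge0.
by have := P 0; have := P 1; rewrite /entry_norm; lra.
Qed.

Lemma op_norm_le x : op_norm x <= entry_norm x.
Proof.
apply: ge_sup; last by move=> _ [v v1 <-]; exact: op_normP.
exists (eucl_norm (x *m 0)), 0 => //=.
by rewrite /eucl_norm sum_ord2 !mxE normc0 expr0n addr0 sqrtr0.
Qed.

(** Each of the four entries is bounded by the length of its column, which is the image of a unit
    vector. *)
Lemma op_norm_ge x : entry_norm x <= 4 * op_norm x.
Proof.
have P i j : normc (x i j) <= op_norm x.
  have vE k : (delta_mx j 0 : 'cV[C]_2) k 0 = (k == j)%:R.
    by rewrite mxE eqxx andbT.
  apply: (@le_trans _ _ (eucl_norm (x *m delta_mx j 0))).
    rewrite -colE /eucl_norm.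
    rewrite -[leLHS]ger0_norm ?normc_ge0// -sqrtr_sqr ler_wsqrtr// sum_ord2 !mxE.
    by case: (ord2E i) => ->; rewrite ?lerDl ?lerDr sqr_ge0.
  apply: ub_le_sup.
    by exists (entry_norm x) => _ [v v1 <-]; exact: op_normP.
  exists (delta_mx j 0) => //=; rewrite /eucl_norm sum_ord2 !vE.
  by case: (ord2E j) => ->; rewrite /= -/(normc _) ?mulr1n ?mulr0n ?expr1n ?expr0n
    ?addr0 ?add0r ?sqrtr1 ?sqrtr0 ?expr1n ?expr0n ?addr0 ?add0r ?sqrtr1.
by rewrite /entry_norm; have := P 0 0; have := P 0 1; have := P 1 0; have := P 1 1; lra.
Qed.

Lemma linftyP (u : mseq R) :
  linfty u <-> exists b : R, forall n, entry_norm (u n) <= b.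
Proof.
split=> -[b ub]; last by exists b => n; rewrite (le_trans (op_norm_le _)).
by exists (4 * b) => n; rewrite (le_trans (op_norm_ge _))// ler_pM2l.
Qed.

Lemma linftyD (u v : mseq R) : linfty u -> linfty v -> linfty (u + v).
Proof.
move=> /linftyP[b ub] /linftyP[c vc]; apply/linftyP; exists (b + c) => n.
by rewrite (le_trans (entry_normD _ _))// lerD.
Qed.

Lemma linftyB (u v : mseq R) : linfty u -> linfty v -> linfty (u - v).
Proof.
move=> /linftyP[b ub] /linftyP[c vc]; apply/linftyP; exists (b + c) => n.
by rewrite (le_trans (entry_normB _ _))// lerD.
Qed.

Lemma sup_norm_ge (u : mseq R) n : linfty u -> entry_norm (u n) <= 4 * sup_norm u.
Proof.
move=> [b ub]; rewrite (le_trans (op_norm_ge _))// ler_pM2l//.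
by apply: ub_le_sup; [exists b => _ [k _ <-] | exists n].
Qed.

Lemma sup_norm_le (u : mseq R) (e : R) :
  (forall n, entry_norm (u n) <= e) -> sup_norm u <= e.
Proof.
move=> ue; apply: ge_sup; first by exists (op_norm (u 0%N)), 0%N.
by move=> _ [n _ <-]; rewrite (le_trans (op_norm_le _)).
Qed.

Lemma c0P (u : mseq R) : c0 u <-> forall e : R, 0 < e ->
  exists N, forall n, (N <= n)%N -> entry_norm (u n) <= e.
Proof.
split=> [/cvgrPdist_le u0 e e0|u0].
  have [|N _ NP] := u0 (e / 4); first by rewrite divr_gt0.
  exists N => n /NP /=; rewrite sub0r normrN => ne.
  rewrite (le_trans (op_norm_ge _))// mulrC -ler_pdivlMr//.
  by rewrite (le_trans (ler_norm _)).
apply/cvgrPdist_le => e /u0[N NP]; exists N => // n /NP /= ne.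
rewrite sub0r normrN ger0_norm ?(le_trans (op_norm_le _))//.
by rewrite -(pmulr_rge0 _ (ltr0Sn R 3)) (le_trans _ (op_norm_ge _))// entry_norm_ge0.
Qed.

End Norms.

(** * Elements of the Akemann-Doner algebra *)

Lemma finite_set_nat_bound (A : set nat) :
  finite_set A -> exists N, forall n, A n -> (n < N)%N.
Proof.
move=> /finite_seqP[s ->]; exists (\max_(i <- s) i).+1 => n /= ns.
by rewrite ltnS (leq_bigmax_seq (F := id)).
Qed.

Lemma infinite_set_nat_ge (A : set nat) : infinite_set A ->
  forall N, exists2 n, (N <= n)%N & A n.
Proof.
move=> Ainf N; apply: contrapT => H; apply: Ainf.
apply: (sub_finite_set _ (finite_II N)) => n An /=.
by rewrite ltnNge; apply/negP => Nn; apply: H; exists n.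
Qed.

Section Projections.
Local Open Scope sesquilinear_scope.
Variable R : realType.
Local Notation normc := ComplexField.Normc.normc.
Implicit Types t : R.

Lemma proj00 t : proj_angle t 0 0 = (sin t ^+ 2)%:C%C.
Proof. by rewrite mxE. Qed.
Lemma proj01 t : proj_angle t 0 1 = (sin t * cos t)%:C%C.
Proof. by rewrite mxE. Qed.
Lemma proj10 t : proj_angle t 1 0 = (sin t * cos t)%:C%C.
Proof. by rewrite mxE. Qed.
Lemma proj11 t : proj_angle t 1 1 = (cos t ^+ 2)%:C%C.
Proof. by rewrite mxE. Qed.
Definition projE := (proj00, proj01, proj10, proj11).

Lemma normc_real t : normc (t%:C%C : R[i]) = `|t|.
Proof. by rewrite /= expr0n addr0 sqrtr_sqr. Qed.

Lemma mx2P (x y : 'M[R[i]]_2) : x 0 0 = y 0 0 -> x 0 1 = y 0 1 ->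
  x 1 0 = y 1 0 -> x 1 1 = y 1 1 -> x = y.
Proof.
move=> ? ? ? ?; apply/matrixP => i j.
by case: (ord2E i) => ->; case: (ord2E j) => ->.
Qed.

Lemma proj_angle_idem t : proj_angle t * proj_angle t = proj_angle t.
Proof.
have s2 := cos2Dsin2 t; apply: mx2P; rewrite mulmx2E !projE -!rmorphM -rmorphD;
  by congr (_%:C%C); rewrite -[RHS]mulr1 -s2; ring.
Qed.

Lemma proj_angle_adj t : (proj_angle t)^t* = proj_angle t :> 'M[R[i]]_2.
Proof. by apply: mx2P; rewrite 2!mxE !projE; exact: conjc_real. Qed.

Lemma proj_angle_norm_le t : entry_norm (proj_angle t) <= 2.
Proof.
rewrite /entry_norm !projE !normc_real !(ger0_norm (sqr_ge0 _)).
have : `|sin t * cos t| <= 1 / 2.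
  have := cos2Dsin2 t; have := sqr_ge0 (sin t - cos t).
  have := sqr_ge0 (sin t + cos t); rewrite ler_norml sqrrD sqrrB.
  by move: (_ ^+ 2) (_ ^+ 2) (_ * _) => x y z; lra.
by have := cos2Dsin2 t; lra.
Qed.

Lemma proj_angle_norm_ge t : 1 <= entry_norm (proj_angle t).
Proof.
rewrite /entry_norm !projE !normc_real !(ger0_norm (sqr_ge0 _)).
have := cos2Dsin2 t; have := normr_ge0 (sin t * cos t); lra.
Qed.

End Projections.

Section Asymptotics.
Local Open Scope sesquilinear_scope.
Variables (R : realType) (F : set (set nat)) (phi : set nat -> R).
Local Notation normc := ComplexField.Normc.normc.
Local Notation "'p_ A" := (proj_angle (phi A)) (at level 8, A at level 2).
Implicit Types u v : mseq R.

(** The scalar [c] may depend on [e], so that passing to norm limits does not require scalars to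
    converge. *)
Definition tail_multiple u : Prop := forall A, F A -> forall e : R, 0 < e ->
  exists c N, forall n, (N <= n)%N -> A n -> entry_norm (u n - c *: 'p_A) <= e.

Definition tail_supported u : Prop := forall e : R, 0 < e ->
  exists L : seq (set nat), exists2 N, (forall A, A \in L -> F A) &
  forall n, (N <= n)%N -> (forall A, A \in L -> ~ A n) -> entry_norm (u n) <= e.

Definition AD_like : set (mseq R) :=
  [set u | [/\ linfty u, tail_multiple u & tail_supported u]].

(** Multiples of one self-adjoint idempotent are stable under products and adjoints, and both tail
    conditions, being stated up to [e], survive uniform limits. *)
Lemma AD_like_cstar : cstar_subalgebra AD_like.
Proof.
have half (e : R) : 0 < e -> 0 < e / 2 by move=> ?; rewrite divr_gt0.
split.
- by move=> u [].
- split.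
  + by apply/linftyP; exists 0 => n; rewrite entry_norm0.
  + move=> A _ e e0; exists 0, 0%N => n _ _.
    by rewrite scale0r subr0 entry_norm0 ltW.
  + by move=> e e0; exists [::], 0%N => // n _ _; rewrite entry_norm0 ltW.
- move=> u v [ul um us] [vl vm vs]; split; first exact: linftyD.
  + move=> A FA e /half e0.
    have [c [N cN]] := um _ FA _ e0; have [d [M dM]] := vm _ FA _ e0.
    exists (c + d), (maxn N M) => n; rewrite geq_max => /andP[Nn Mn] An.
    rewrite [_ - _](_ : _ = (u n - c *: 'p_A) + (v n - d *: 'p_A)).
      by rewrite (le_trans (entry_normD _ _))// (splitr e) lerD// ?cN ?dM.
    by rewrite scalerDl opprD addrACA.
  + move=> e /half e0; have [L [N LF LN]] := us _ e0.
    have [K [M KF KM]] := vs _ e0; exists (L ++ K), (maxn N M).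
      by move=> A; rewrite mem_cat => /orP[/LF|/KF].
    move=> n; rewrite geq_max => /andP[Nn Mn] nLK.
    rewrite (le_trans (entry_normD _ _))// (splitr e) lerD//.
      by apply: LN => // A AL; apply: nLK; rewrite mem_cat AL.
    by apply: KM => // A AL; apply: nLK; rewrite mem_cat AL orbT.
- move=> a u [ul um us].
  have a0 := normc_ge0 a.
  have ae (e : R) : 0 < e -> 0 < e / (normc a + 1).
    by move=> e0; rewrite divr_gt0// ltr_wpDl.
  have ale (e : R) s : 0 < e -> s <= e / (normc a + 1) -> normc a * s <= e.
    rewrite ler_pdivlMr ?ltr_wpDl// => e0 H.
    have [s0|s0] := leP 0 s; nra.
  split.
  + have /linftyP[b ub] := ul; apply/linftyP; exists (normc a * b) => n.
    by rewrite entry_normZ ler_wpM2l.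
  + move=> A FA e e0; have [c [N cN]] := um _ FA _ (ae _ e0).
    exists (a * c), N => n Nn An; rewrite -scalerA -scalerBr entry_normZ.
    by apply: ale => //; exact: cN.
  + move=> e e0; have [L [N LF LN]] := us _ (ae _ e0).
    exists L, N => // n Nn nL; rewrite entry_normZ.
    by apply: ale => //; exact: LN.
- move=> u v [ul um us] [vl vm vs].
  have /linftyP[b ub] := ul; have /linftyP[b' vb] := vl.
  have b0 : 0 <= b by rewrite (le_trans (entry_norm_ge0 (u 0%N))).
  have b'0 : 0 <= b' by rewrite (le_trans (entry_norm_ge0 (v 0%N))).
  split.
  + apply/linftyP; exists (b * b') => n.
    by rewrite (le_trans (entry_normM _ _))// ler_pM ?entry_norm_ge0.
  (* The two error terms of the product are at most [b * d] and [d * (b' + 1)]; the bound [d <= 1]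
     is what gives norm at most [b' + 1] to the multiple of the projection near [v]. *)
  + move=> A FA e e0; pose d := Num.min 1 (e / (b + b' + 1)).
    have d0 : 0 < d by rewrite lt_min ltr01 divr_gt0// ltr_wpDl// addr_ge0.
    have d1 : d <= 1 by rewrite ge_min lexx.
    have de : d * (b + b' + 1) <= e.
      by rewrite -ler_pdivlMr ?ltr_wpDl ?addr_ge0// ge_min lexx orbT.
    have [c [N cN]] := um _ FA _ d0; have [c' [M dM]] := vm _ FA _ d0.
    exists (c * c'), (maxn N M) => n; rewrite geq_max => /andP[Nn Mn] An.
    rewrite [_ - _](_ : _ = u n * (v n - c' *: 'p_A) +
      (u n - c *: 'p_A) * (c' *: 'p_A)); last first.
      rewrite mulrBr mulrBl addrA subrK -scalerAl -scalerAr scalerA.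
      by rewrite proj_angle_idem.
    have c'p : entry_norm (c' *: 'p_A) <= b' + 1.
      rewrite -[c' *: _](subKr (v n)) (le_trans (entry_normB _ _))//.
      by rewrite lerD// (le_trans (dM n Mn An)).
    have uvd : entry_norm (u n * (v n - c' *: 'p_A)) <= b * d.
      rewrite (le_trans (entry_normM _ _))// ler_pM ?entry_norm_ge0//.
      exact: dM.
    have udv : entry_norm ((u n - c *: 'p_A) * (c' *: 'p_A)) <= d * (b' + 1).
      rewrite (le_trans (entry_normM _ _))// ler_pM ?entry_norm_ge0//.
      exact: cN.
    by rewrite (le_trans (entry_normD _ _))// (le_trans (lerD uvd udv))//; lra.
  + move=> e e0; have b1 : 0 < b' + 1 by rewrite ltr_wpDl.
    have [|L [N LF LN]] := us (e / (b' + 1)); first by rewrite divr_gt0.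
    exists L, N => // n Nn nL; have := LN n Nn nL; rewrite ler_pdivlMr// => une.
    rewrite (le_trans (entry_normM _ _))// (le_trans _ une)//.
    by rewrite ler_wpM2l ?entry_norm_ge0// (le_trans (vb n))// lerDl.
- move=> u [ul um us]; split.
  + by have /linftyP[b ub] := ul; apply/linftyP; exists b => n; rewrite entry_norm_adj.
  + move=> A FA e e0; have [c [N cN]] := um _ FA _ e0.
    exists (Num.conj c), N => n Nn An.
    have -> : adjoint u n - Num.conj c *: 'p_A = (u n - c *: 'p_A)^t*.
      rewrite -[in LHS](proj_angle_adj (phi A)).
      by apply/matrixP => i j; rewrite !mxE rmorphB rmorphM.
    by rewrite entry_norm_adj cN.
  + move=> e e0; have [L [N LF LN]] := us _ e0.
    by exists L, N => // n Nn nL; rewrite entry_norm_adj LN.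
- move=> u ul uV.
  have app (e : R) : 0 < e -> exists2 v, AD_like v &
      forall n, entry_norm (u n - v n) <= e.
    move=> e0; have [|v Vv uv] := uV (e / 4); first by rewrite divr_gt0.
    exists v => // n; have [vl _ _] := Vv.
    have := sup_norm_ge n (linftyB ul vl); rewrite -[(u - v) n]/(u n - v n).
    by lra.
  split => //.
  + move=> A FA e /half e0; have [v [_ vm _] uv] := app _ e0.
    have [c [N cN]] := vm _ FA _ e0; exists c, N => n Nn An.
    by rewrite (le_trans (entry_normDB (v n) _ _))// (splitr e) lerD ?uv ?cN.
  + move=> e /half e0; have [v [_ _ vs] uv] := app _ e0.
    have [L [N LF LN]] := vs _ e0; exists L, N => // n Nn nL.
    have := entry_normD (u n - v n) (v n); rewrite subrK.
    by have := uv n; have := LN n Nn nL; lra.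
Qed.

Hypothesis F_ad : almost_disjoint F.

(** It suffices to check the generators. A null sequence has scalar 0 on every member; the sequence
    of [A] has scalar 1 on [A], and scalar 0 on any other member, which meets [A] in a finite
    set. *)
Lemma AD_sub_like : AD F phi `<=` AD_like.
Proof.
apply: smallest_sub; first exact: AD_like_cstar.
have [_ _ adF] := F_ad.
move=> u [/c0P u0|[A FA <-]].
- split.
  + have [N uN] := u0 1 ltr01; apply/linftyP.
    exists (1 + \sum_(i < N) entry_norm (u i)) => n.
    have s0 : 0 <= \sum_(i < N) entry_norm (u i).
      by apply: sumr_ge0 => i _; exact: entry_norm_ge0.
    have [/uN un|nN] := leqP N n; first by rewrite (le_trans un)// lerDl.
    rewrite (bigD1 (Ordinal nN))//= addrCA lerDl addr_ge0//.
    by apply: sumr_ge0 => i _; exact: entry_norm_ge0.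
  + move=> A _ e /u0[N uN]; exists 0, N => n Nn _.
    by rewrite scale0r subr0 uN.
  + by move=> e /u0[N uN]; exists [::], N => // n Nn _; exact: uN.
- have PA n : A n -> proj_seq A (phi A) n = 'p_A.
    by move=> An; rewrite /proj_seq mem_set.
  have PnA n : ~ A n -> proj_seq A (phi A) n = 0.
    by move=> An; rewrite /proj_seq memNset.
  split.
  + apply/linftyP; exists 2 => n.
    have [An|An] := pselect (A n); first by rewrite PA// proj_angle_norm_le.
    by rewrite PnA// entry_norm0.
  + move=> B FB e e0; have [<-|AB] := pselect (A = B).
      exists 1, 0%N => n _ An; rewrite PA// scale1r subrr entry_norm0; exact: ltW.
    have [k kP] := finite_set_nat_bound (adF _ _ FA FB AB).
    exists 0, k => n kn Bn; rewrite scale0r subr0 PnA ?entry_norm0 ?ltW// => An.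
    by have := kP n (conj An Bn); rewrite ltnNge kn.
  + move=> e e0; exists [:: A], 0%N => [B|n _ nA].
      by rewrite inE => /eqP ->.
    by rewrite PnA ?entry_norm0 ?ltW//; apply: nA; rewrite mem_head.
Qed.

End Asymptotics.

(** * Commutative subalgebras *)

Section Commutants.
Variable R : realType.
Local Notation normc := ComplexField.Normc.normc.
Local Notation M2 := 'M[R[i]]_2.

Definition is_scalar2 (m : M2) : Prop :=
  [/\ m 0 1 = 0, m 1 0 = 0 & m 0 0 = m 1 1].

(** To a matrix attach the triple of its off-diagonal entries and the difference of its diagonal
    ones. Commutation says that the 2x2 minors of the two triples vanish, and the triple of [m] is
    nonzero. The conclusion means that [x - t *: m] is scalar. *)
Lemma commute_nonscalar (m x : M2) : ~ is_scalar2 m -> x * m = m * x ->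
  exists t, [/\ x 0 1 = t * m 0 1, x 1 0 = t * m 1 0 &
                x 0 0 - x 1 1 = t * (m 0 0 - m 1 1)].
Proof.
move=> mns /matrixP xm; have := xm 0 0; have := xm 0 1; have := xm 1 0.
rewrite !mulmx2E; move: mns; rewrite /is_scalar2.
move: (m 0 0) (m 0 1) (m 1 0) (m 1 1) (x 0 0) (x 0 1) (x 1 0) (x 1 1).
move=> a b c d p q r s mns e10 e01 e00.
have E1 : q * c = r * b by apply: (addrI (p * a)); rewrite e00; ring.
have E2 : (p - s) * b = q * (a - d).
  have -> : (p - s) * b = (p * b + q * d) - q * d - s * b by ring.
  by rewrite e01; ring.
have E3 : (p - s) * c = r * (a - d).
  have -> : (p - s) * c = p * c - (r * a + s * c) + r * a by ring.
  by rewrite e10; ring.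
have [b0|b0] := eqVneq b 0; last first.
  exists (q / b); split; [by field| |]; apply: (mulIf b0).
    by rewrite -E1; field.
  by rewrite E2; field.
have [c0|c0] := eqVneq c 0; last first.
  exists (r / c); split; [|by field|]; apply: (mulIf c0).
    by rewrite E1; field.
  by rewrite E3; field.
have [ad|ad] := eqVneq (a - d) 0.
  by exfalso; apply: mns; split => //; apply/eqP; rewrite -subr_eq0 ad.
exists ((p - s) / (a - d)); split; [| |by field]; apply: (mulIf ad).
  by rewrite -E2 b0; ring.
by rewrite -E3 c0; ring.
Qed.

Lemma commutant_comm (m x y : M2) : ~ is_scalar2 m ->
  x * m = m * x -> y * m = m * y -> x * y = y * x.
Proof.
move=> mns /(commute_nonscalar mns)[t [x01 x10 xd]].
move=> /(commute_nonscalar mns)[u [y01 y10 yd]].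
have {}xd : x 0 0 = x 1 1 + t * (m 0 0 - m 1 1) by rewrite -xd; ring.
have {}yd : y 0 0 = y 1 1 + u * (m 0 0 - m 1 1) by rewrite -yd; ring.
by apply: mx2P; rewrite !mulmx2E ?x01 ?x10 ?xd ?y01 ?y10 ?yd; ring.
Qed.

(** The off-diagonal entry of the commutator is [cos (s - t) * sin (s - t)], and the cosine is
    positive because [s - t] lies strictly between [- (pi / 2)] and [pi / 2]. *)
Lemma proj_angle_comm_inj (s t : R) : 0 <= s < pi / 2 -> 0 <= t < pi / 2 ->
  proj_angle s * proj_angle t = proj_angle t * proj_angle s -> s = t.
Proof.
move=> /andP[s0 sp] /andP[t0 tp] /matrixP/(_ 0 1).
rewrite !mulmx2E !projE -!rmorphM -!rmorphD => /complexI H.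
have : cos (s - t) * sin (s - t) = 0.
  rewrite cosB sinB.
  transitivity ((sin s ^+ 2 * (sin t * cos t) + sin s * cos s * cos t ^+ 2) -
                (sin t ^+ 2 * (sin s * cos s) + sin t * cos t * cos s ^+ 2)).
    by ring.
  by rewrite H subrr.
have c0 : 0 < cos (s - t) by apply: cos_gt0_pihalf; lra.
move=> /eqP; rewrite mulf_eq0 gt_eqF//= => /eqP st0.
have : s - t = 0.
  have /sinK : s - t \in `[- (pi / 2), pi / 2] by rewrite in_itv /=; lra.
  have /sinK : 0 \in `[- (pi / 2), pi / 2 : R] by rewrite in_itv /=; lra.
  by rewrite sin0 st0 => -> <-.
by move/eqP; rewrite subr_eq0 => /eqP.
Qed.

(* [m] pins down [t]: the commutant of a non-scalar [m n] is commutative,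
   whereas [proj_angle] takes non-commuting values on [[0, pi/2[]. *)
Definition commutant_limit (m : mseq R) (A : set nat) (t : R) : Prop :=
  forall d : R, 0 < d -> exists N, forall n, (N <= n)%N -> A n ->
    ~ is_scalar2 (m n) /\
    exists2 x, x * m n = m n * x & entry_norm (x - proj_angle t) <= d.

Lemma entry_norm_eq0 (x : M2) : entry_norm x = 0 -> x = 0.
Proof.
move=> x0; have P i j : x i j = 0.
  apply: ComplexField.Normc.eq0_normc; apply/eqP.
  by rewrite eq_le normc_ge0 andbT -x0 entry_norm_ge.
by apply: mx2P; rewrite P mxE.
Qed.

(** At a far point [n] of [A], matrices close to the two projections both commute with [m n], hence
    with each other; so the projections commute up to an arbitrarily small error. *)
Lemma commutant_limit_inj m A (s t : R) : infinite_set A ->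
  0 <= s < pi / 2 -> 0 <= t < pi / 2 ->
  commutant_limit m A s -> commutant_limit m A t -> s = t.
Proof.
move=> Ainf s_itv t_itv mAs mAt; apply: proj_angle_comm_inj => //.
set p := proj_angle s; set q := proj_angle t.
(* The constant is 2 + 2 + 3 + 3: the commutator splits into four products of a factor of norm at
   most [d] with [q], of norm at most 2, or with [x], of norm at most 3. *)
have small (d : R) : 0 < d -> d <= 1 -> entry_norm (p * q - q * p) <= 10 * d.
  move=> d0 d1; have [N Ns] := mAs _ d0; have [M Mt] := mAt _ d0.
  have [n] := infinite_set_nat_ge Ainf (maxn N M).
  rewrite geq_max => /andP[/Ns{}Ns /Mt{}Mt] An.
  have [mns [x xm xp]] := Ns An; have [_ [y ym yq]] := Mt An.
  have xy := commutant_comm mns xm ym.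
  have np : entry_norm p <= 2 by exact: proj_angle_norm_le.
  have nq : entry_norm q <= 2 by exact: proj_angle_norm_le.
  have nx : entry_norm x <= 3.
    by rewrite -[x](subrK p) (le_trans (entry_normD _ _))//; lra.
  have -> : p * q - q * p =
      (q * (x - p) - (x - p) * q) + ((y - q) * x - x * (y - q)).
    rewrite !mulrBr !mulrBl xy !opprB addrACA; apply/matrixP => i j.
    by rewrite !mxE; ring.
  have b1 : entry_norm (q * (x - p)) <= 2 * d.
    by rewrite (le_trans (entry_normM _ _))// ler_pM ?entry_norm_ge0.
  have b2 : entry_norm ((x - p) * q) <= d * 2.
    by rewrite (le_trans (entry_normM _ _))// ler_pM ?entry_norm_ge0.
  have b3 : entry_norm ((y - q) * x) <= d * 3.
    by rewrite (le_trans (entry_normM _ _))// ler_pM ?entry_norm_ge0.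
  have b4 : entry_norm (x * (y - q)) <= 3 * d.
    by rewrite (le_trans (entry_normM _ _))// ler_pM ?entry_norm_ge0.
  have := entry_normD (q * (x - p) - (x - p) * q) ((y - q) * x - x * (y - q)).
  have := entry_normB (q * (x - p)) ((x - p) * q).
  have := entry_normB ((y - q) * x) (x * (y - q)); lra.
apply/eqP; rewrite -subr_eq0; apply/eqP/entry_norm_eq0/eqP.
rewrite eq_le entry_norm_ge0 andbT leNgt; apply/negP => c0.
pose d : R := Num.min 1 (entry_norm (p * q - q * p) / 20).
have d0 : 0 < d by rewrite lt_min ltr01 divr_gt0.
have : d <= 1 by rewrite ge_min lexx.
have : d <= entry_norm (p * q - q * p) / 20 by rewrite ge_min lexx orbT.
by move=> dle /(small _ d0); lra.
Qed.

(** If [b] is not null on [A], the scalars [c] stay away from 0, so [c^-1 *: b n] is close to the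
    projection and commutes with [m n]. So close to a rank-one projection there is no scalar matrix,
    hence [m n] is not scalar either. *)
Lemma commutative_commutant_limit (B : set (mseq R)) : commutative_set B ->
  exists m : mseq R, forall A (t : R) b, B b ->
  (forall e : R, 0 < e -> exists c N, forall n, (N <= n)%N -> A n ->
     entry_norm (b n - c *: proj_angle t) <= e) ->
  ~ (forall e : R, 0 < e -> exists N, forall n, (N <= n)%N -> A n ->
     entry_norm (b n) <= e) ->
  commutant_limit m A t.
Proof.
move=> Bcomm.
have /choice[m mP] n : exists x : M2,
    (forall b, B b -> b n * x = x * b n) /\
    forall b, B b -> ~ is_scalar2 (b n) -> ~ is_scalar2 x.
  have [[b Bb bn]|H] := pselect (exists2 b, B b & ~ is_scalar2 (b n)).
    exists (b n); split => // b' Bb'.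
    by have := congr1 (fun u : mseq R => u n) (Bcomm _ _ Bb' Bb).
  exists 0; split => [b _|b Bb bn]; first by rewrite mulr0 mul0r.
  by exfalso; apply: H; exists b.
exists m => A t b Bb bmult /existsNP[e] /not_implyP[e0].
move=> /forallNP bfreq d d0.
(* A scalar matrix within 1/8 of the projection would give [|sin t * cos t| <= 1 / 8] and
   [|sin t ^+ 2 - cos t ^+ 2| <= 1 / 4], against the identity of squares [(sin t ^+ 2 - cos t ^+ 2)
   ^+ 2 + 4 * (sin t * cos t) ^+ 2 = 1]. *)
pose d' : R := Num.min d (1 / 8).
have d'0 : 0 < d' by rewrite lt_min d0 divr_gt0.
have d'd : d' <= d by rewrite ge_min lexx.
have d'8 : d' <= 1 / 8 by rewrite ge_min lexx orbT.
(* Division by [c], of modulus at least [e / 4], turns this error into [d']. The lower bound on [c]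
   comes from a point of [A] where [b] exceeds [e], the projection having norm at most 2. *)
have [|c [N cN]] := bmult (d' * (e / 4)); first by rewrite mulr_gt0// divr_gt0.
have ce : e / 4 <= normc c.
  have /existsNP[n /not_implyP[Nn /not_implyP[An /negP]]] := bfreq N.
  rewrite -ltNge => be; have := cN n Nn An => bc.
  have := entry_normD (b n - c *: proj_angle t) (c *: proj_angle t).
  rewrite subrK entry_normZ; have := proj_angle_norm_le t.
  have := proj_angle_norm_ge t; have := normc_ge0 c.
  move: (entry_norm (proj_angle t)) (normc c) => P C C0 P1 P2 H.
  have : d' * (e / 4) <= 1 / 8 * (e / 4) by rewrite ler_wpM2r// ltW// divr_gt0.
  nra.
have nc0 : 0 < normc c by apply: lt_le_trans ce; rewrite divr_gt0.
have c0 : c != 0 by apply: contraTN nc0 => /eqP ->; rewrite normc0 ltxx.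
exists N => n Nn An; have [mcomm mns] := mP n.
have close : entry_norm (c^-1 *: b n - proj_angle t) <= d'.
  rewrite -[proj_angle t](scalerK c0) -scalerBr entry_normZ.
  rewrite ComplexField.Normc.normcV mulrC ler_pdivrMr//.
  by rewrite (le_trans (cN n Nn An))// ler_wpM2l// ltW.
split; last first.
  exists (c^-1 *: b n); last exact: le_trans close _.
  by rewrite -scalerAl -scalerAr mcomm.
apply: (mns _ Bb) => -[b01 b10 bd].
have small i j := le_trans (entry_norm_ge (c^-1 *: b n - proj_angle t) i j) close.
have := small 0 0; have := small 0 1; have := small 1 1.
have XE i j : (c^-1 *: b n - proj_angle t) i j = c^-1 * b n i j - proj_angle t i j.
  by rewrite !mxE.
rewrite !XE bd b01 mulr0 sub0r normcN !projE normc_real => h11 h01 h00.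
have := le_normcD (c^-1 * b n 1 1 - (cos t ^+ 2)%:C%C)
  (- (c^-1 * b n 1 1 - (sin t ^+ 2)%:C%C)).
rewrite normcN opprB [_ + _](_ : _ = (sin t ^+ 2 - cos t ^+ 2)%:C%C); last first.
  by rewrite rmorphB /= addrC addrA subrK.
rewrite normc_real => hd.
have {hd h00 h11} : `|sin t ^+ 2 - cos t ^+ 2| <= 1 / 4.
  by apply: (le_trans hd); lra.
have {}h01 := le_trans h01 d'8.
move: h01; rewrite !ler_norml => /andP[p1 p2] /andP[q1 q2].
have := cos2Dsin2 t; move: p1 p2 q1 q2; rewrite !expr2.
by move: (sin t) (cos t) => u v p1 p2 q1 q2 uv; nra.
Qed.

End Commutants.

(** * Densities *)

Section Density.
Variable R : realType.
Local Notation M2 := 'M[R[i]]_2.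
Local Notation normc := ComplexField.Normc.normc.

Definition grid (k : nat) (r : R) : int := Num.floor (r * k.+1%:R).

Lemma grid_eq k r s : grid k r = grid k s -> `|r - s| <= k.+1%:R^-1.
Proof.
rewrite /grid => rs; have k0 : 0 < k.+1%:R :> R by rewrite ltr0n.
have := floor_itv (r * k.+1%:R); have := floor_itv (s * k.+1%:R); rewrite rs.
rewrite intrD; move: (_%:~R) => z /andP[z1 z2] /andP[z3 z4].
rewrite -[leRHS]mul1r ler_pdivlMr// -[k.+1%:R]gtr0_norm// -normrM.
by rewrite mulrBl ler_norml; lra.
Qed.

Definition grid_mx (k : nat) (x : M2) : seq int :=
  [:: grid k (complex.Re (x 0 0)); grid k (complex.Im (x 0 0));
      grid k (complex.Re (x 0 1)); grid k (complex.Im (x 0 1));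
      grid k (complex.Re (x 1 0)); grid k (complex.Im (x 1 0));
      grid k (complex.Re (x 1 1)); grid k (complex.Im (x 1 1))].

Lemma grid_mx_eq k x y : grid_mx k x = grid_mx k y ->
  entry_norm (x - y) <= 8 / k.+1%:R.
Proof.
have le_ReIm (z : R[i]) : normc z <= `|complex.Re z| + `|complex.Im z|.
  case: z => a b /=.
  rewrite -[leRHS]ger0_norm ?addr_ge0// -sqrtr_sqr ler_wsqrtr//.
  by rewrite sqrrD !real_normK ?num_real// lerD2r lerDl mulrn_wge0// mulr_ge0.
have P i j : grid k (complex.Re (x i j)) = grid k (complex.Re (y i j)) ->
    grid k (complex.Im (x i j)) = grid k (complex.Im (y i j)) ->
    normc ((x - y) i j) <= 2 / k.+1%:R.
  move=> /grid_eq re /grid_eq im; rewrite (le_trans (le_ReIm _))// !mxE.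
  by move: (x i j) (y i j) (k.+1%:R^-1) re im => [a b] [c d] K /= re im; lra.
move=> [*]; rewrite /entry_norm.
have : normc ((x - y) 0 0) <= 2 / k.+1%:R by exact: P.
have : normc ((x - y) 0 1) <= 2 / k.+1%:R by exact: P.
have : normc ((x - y) 1 0) <= 2 / k.+1%:R by exact: P.
have : normc ((x - y) 1 1) <= 2 / k.+1%:R by exact: P.
by move: (k.+1%:R^-1) => K; lra.
Qed.

Variables (F : set (set nat)) (phi : set nat -> R).

(** Finite data fixing [u] up to [10 / k.+1]: the members on which its tail is recorded, and one
    natural number for all the rest. The precision [k] is part of that number, so that it can be
    read back. *)
Definition skeleton (k : nat) (u : mseq R) (t : seq (set nat) * nat) : Prop :=
  exists X : set nat -> M2, exists N,
  [/\ forall n A, (N <= n)%N -> A \in t.1 -> A n ->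
        entry_norm (u n - X A) <= k.+1%:R^-1,
      forall n, (N <= n)%N -> (forall A, A \in t.1 -> ~ A n) ->
        entry_norm (u n) <= k.+1%:R^-1 &
      t.2 = pickle (k, N, [seq grid_mx k (X A) | A <- t.1],
                          [seq grid_mx k (u n) | n <- iota 0 N])].

(** On a listed member the error is 1 + 8 + 1 in units of [k.+1%:R^-1], the 8 coming from rounding
    [X A] and [Y A]; before [N] it is 8, and elsewhere 1 + 1. *)
Lemma skeleton_close k u v t : skeleton k u t -> skeleton k v t ->
  forall n, entry_norm (u n - v n) <= 10 / k.+1%:R.
Proof.
move=> [X [N [uX u0 t2]]] [Y [M [vY v0]]]; rewrite {}t2.
move=> /(pcan_inj pickleK)[NM XY uv] n; rewrite -{M}NM in vY v0 uv.
have k0 : 0 < k.+1%:R^-1 :> R by rewrite invr_gt0 ltr0n.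
have [Nn|nN] := leqP N n; last first.
  apply: (@le_trans _ _ (8 / k.+1%:R)); last by move: (k.+1%:R^-1) k0 => K; lra.
  by apply: grid_mx_eq; have/eq_in_map/(_ n) := uv; rewrite mem_iota add0n nN; apply.
have [[A [At An]]|H] := pselect (exists A, A \in t.1 /\ A n); last first.
  have nA A : A \in t.1 -> ~ A n by move=> At An; apply: H; exists A.
  by have := u0 n Nn nA; have := v0 n Nn nA; have := entry_normB (u n) (v n);
    move: (k.+1%:R^-1) k0 => K; lra.
have {}XY : grid_mx k (X A) = grid_mx k (Y A) by have/eq_in_map := XY; apply.
have := grid_mx_eq XY; have := uX n A Nn At An; have := vY n A Nn At An.
have := entry_normDB (X A) (u n) (v n); have := entry_normDB (Y A) (X A) (v n).
by rewrite (entry_normC (Y A)); move: (k.+1%:R^-1) k0 => K; lra.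
Qed.

Lemma skeleton_ex (G : set (set nat)) u k : AD_like F phi u ->
  (forall A, F A -> ~ G A -> forall e : R, 0 < e ->
    exists N, forall n, (N <= n)%N -> A n -> entry_norm (u n) <= e) ->
  exists2 t, skeleton k u t & forall A, A \in t.1 -> F A /\ G A.
Proof.
move=> [_ um us] uG; have k0 : 0 < k.+1%:R^-1 :> R by rewrite invr_gt0 ltr0n.
have [L [N LF LN]] := us _ k0.
have /choice[XM XMP] A : exists p : M2 * nat, F A -> forall n, (p.2 <= n)%N ->
    A n -> entry_norm (u n - p.1) <= k.+1%:R^-1 /\
           (~ G A -> entry_norm (u n) <= k.+1%:R^-1).
  have [FA|nFA] := pselect (F A); last by exists (0, 0%N).
  have [GA|nGA] := pselect (G A).
    have [c [M cM]] := um _ FA _ k0.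
    by exists (c *: proj_angle (phi A), M) => _ n Mn An; split => //; exact: cM.
  have [M uM] := uG _ FA nGA _ k0.
  by exists (0, M) => _ n Mn An; rewrite subr0; split => [|_]; exact: uM.
pose L' := [seq A <- L | `[< G A >]].
have L'P A : A \in L' -> A \in L /\ G A.
  by rewrite mem_filter => /andP[/asboolP].
pose N' := maxn N (\max_(A <- L) (XM A).2).
have N'P n A : (N' <= n)%N -> A \in L -> ((XM A).2 <= n)%N.
  rewrite geq_max => /andP[_ Mn] AL; apply: leq_trans Mn.
  exact: (leq_bigmax_seq (F := fun A => (XM A).2)).
pose X A := (XM A).1.
exists (L', pickle (k, N', [seq grid_mx k (X A) | A <- L'],
                           [seq grid_mx k (u n) | n <- iota 0 N'])).
  exists X, N'; split => //= n.
    move=> A Nn /L'P[AL GA] An.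
    by have [] := XMP A (LF _ AL) n (N'P _ _ Nn AL) An.
  move=> Nn nL'; have [[A [AL An]]|H] := pselect (exists A, A \in L /\ A n).
    have [_] := XMP A (LF _ AL) n (N'P _ _ Nn AL) An; apply.
    by move=> GA; apply: (nL' A) => //; rewrite mem_filter AL andbT; apply/asboolP.
  apply: LN; first by move: Nn; rewrite geq_max => /andP[].
  by move=> A AL An; apply: H; exists A.
by move=> A /L'P[/LF].
Qed.

Lemma sup_norm_lt_ex (e : R) : 0 < e -> exists k : nat, 10 / k.+1%:R < e.
Proof.
move=> e0; exists (Num.bound (10 / e)); rewrite ltr_pdivrMr ?ltr0n//.
rewrite mulrC -ltr_pdivrMr// (lt_le_trans (archi_boundP _))//.
  by rewrite divr_ge0// ltW.
by rewrite ler_nat.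
Qed.

(* A dense subset is obtained by choosing one element of [B] for each skeleton
   that occurs; skeletons are finite words over [G] and the integers. *)
Lemma density_word_large (G : set (set nat)) (B : set (mseq R))
    (j : set nat -> R) :
  {in F &, injective j} -> B `<=` AD_like F phi ->
  (forall u, B u -> forall A, F A -> ~ G A -> forall e : R, 0 < e ->
    exists N, forall n, (N <= n)%N -> A n -> entry_norm (u n) <= e) ->
  (forall D, norm_dense_in D B -> [set: R] #<= D) ->
  word_large (j @` (F `&` G)).
Proof.
move=> ji BV BG Bdense.
have /choice[key keyP] (p : mseq R * nat) : exists t, B p.1 ->
    skeleton p.2 p.1 t /\ forall A, A \in t.1 -> F A /\ G A.
  have [Bp|nBp] := pselect (B p.1); last by exists ([::], 0%N).
  by have [t tP tG] := skeleton_ex p.2 (BV _ Bp) (BG _ Bp); exists t.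
pose rep k t := xget (0 : mseq R) [set b | B b /\ key (b, k) = t].
have repP b k : B b -> B (rep k (key (b, k))) /\
    key (rep k (key (b, k)), k) = key (b, k).
  move=> Bb; apply: (xgetPex (0 : mseq R)
    (P := [set b' | B b' /\ key (b', k) = key (b, k)])).
  by exists b.
pose D : set (mseq R) := [set u | exists b k, B b /\ u = rep k (key (b, k))].
have /Bdense/card_le_realP[f fi fD] : norm_dense_in D B.
  split=> [u [b [k [Bb ->]]]|b Bb e e0]; first by have [] := repP b k Bb.
  have [k ke] := sup_norm_lt_ex e0; have [Br kr] := repP b k Bb.
  exists (rep k (key (b, k))); first by exists b, k.
  apply: le_lt_trans ke; apply: sup_norm_le.
  have [bs _] := keyP (b, k) Bb; have [rs _] := keyP (_, k) Br.
  by rewrite kr in rs; exact: skeleton_close bs rs.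
have /choice[bk bkP] x : exists p, B p.1 /\ f x = rep p.2 (key p).
  by have [b [k [Bb fx]]] := fD x; exists (b, k).
exists (fun x => inr (key (bk x)).2 :: [seq inl (j A) | A <- (key (bk x)).1]).
  move=> x y [n_eq A_eq]; apply: fi.
  have [Bx ->] := bkP x; have [By ->] := bkP y.
  have [[X [N [_ _ nx]]] Ax] := keyP _ Bx.
  have [[Y [M [_ _ ny]]] Ay] := keyP _ By.
  have -> : (bk x).2 = (bk y).2.
    by move: n_eq; rewrite nx ny => /(pcan_inj pickleK)[].
  congr (rep _ _); rewrite [LHS]surjective_pairing [RHS]surjective_pairing n_eq.
  congr (_, _); move: Ax Ay A_eq; move: (key _).1 (key _).1 => s s'.
  (* The words are compared letter by letter because [j] is injective on [F] only. *)
  elim: s s' => [|A' s' IH] [|A s] //= sF s'F [jA ss']; congr cons.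
    have [FA _] := sF A (mem_head _ _); have [FA' _] := s'F A' (mem_head _ _).
    by apply: ji jA; rewrite inE.
  apply: IH => // C Cs; [apply: sF|apply: s'F]; by rewrite inE Cs orbT.
move=> x y; rewrite inE /= => /mapP[A As [->]].
by exists A => //; have [Bx _] := bkP x; have [_] := keyP _ Bx; apply.
Qed.

(** The algebra serves as its own dense subset, there being at most continuum many sequences of
    matrices. Conversely the generators of distinct members are uniformly separated, so their
    approximants in a dense set are distinct. *)
Lemma AD_density : almost_disjoint F -> F #= [set: R] ->
  has_density (AD F phi) [set: R].
Proof.
move=> F_ad F_card; have [_ Finf adF] := F_ad.
have AD_V := @AD_sub_like R F phi F_ad.
have sup0 (u : mseq R) : sup_norm (u - u) <= 0.
  by apply: sup_norm_le => n; rewrite subrr entry_norm0.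
have gen A : F A -> AD F phi (proj_seq A (phi A)).
  by move=> FA; apply: sub_gen_smallest; right; exists A.
have large D : norm_dense_in D (AD F phi) -> [set: R] #<= D.
  move=> [DAD Ddense].
  (* The factor 4 turns 1/16 into 1/4. A common approximant for [A] and [C] would then give norm at
     most 1/2 to a projection, of norm at least 1, at a point of [A] outside [C]. *)
  have /choice[d dP] A : exists u, F A ->
      D u /\ sup_norm (proj_seq A (phi A) - u) < 1 / 16.
    have [FA|nFA] := pselect (F A); last by exists 0.
    by have [|u Du ud] := Ddense _ (gen A FA) (1 / 16); [|exists u].
  have dclose A n : F A ->
      entry_norm (proj_seq A (phi A) n - d A n) <= 1 / 4.
    move=> FA; have [Du ud] := dP A FA.
    have [ul _ _] := AD_V _ (DAD _ Du); have [pl _ _] := AD_V _ (gen A FA).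
    have := sup_norm_ge n (linftyB pl ul); rewrite -[(_ - d A) n]/(_ - d A n).
    by lra.
  move: F_card; rewrite card_eq_sym card_eq_le => /andP[RF _].
  apply: (card_le_trans RF); apply: (inj_card_le_real (f := d)).
    by move=> A /dP[].
  move=> A C; rewrite !inE => FA FC dAC; apply: contrapT => AC.
  have [N NP] := finite_set_nat_bound (adF _ _ FA FC AC).
  have [n Nn An] := infinite_set_nat_ge (Finf _ FA) N.
  have nC : ~ C n by move=> Cn; have := NP n (conj An Cn); rewrite ltnNge Nn.
  have := dclose A n FA; have := dclose C n FC.
  rewrite /proj_seq (mem_set An) (memNset nC) sub0r entry_normN dAC => h1 h2.
  have := entry_normD (proj_angle (phi A) - d C n) (d C n); rewrite subrK.
  by have := proj_angle_norm_ge (phi A); lra.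
split => //; exists (AD F phi).
have dense : norm_dense_in (AD F phi) (AD F phi).
  by split => // u ADu e e0; exists u => //; exact: le_lt_trans (sup0 u) e0.
split => //; rewrite card_eq_le large// andbT.
have [e ei] := mseq_inj_real R.
by apply: (inj_card_le_real (f := e)) => // u v _ _ /ei.
Qed.

End Density.

(** * Choice of the angles and conclusion *)

(** If no angle were free at [A], every angle in [[0, pi/2[] would be a limit for some [m] with
    [le (e m) (j A)]. Distinct angles need distinct [m], so the reals would inject into a small
    segment. *)
Lemma diagonal_angles (R : realType) (F : set (set nat))
    (le : R -> R -> Prop) (j : set nat -> R) (e : mseq R -> R) :
  almost_disjoint F -> injective e ->
  (forall y, ~ word_large [set x | le x y]) ->
  exists phi : set nat -> R, forall A, F A -> 0 <= phi A < pi / 2 /\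
    forall m, commutant_limit m A (phi A) -> ~ le (e m) (j A).
Proof.
move=> [_ Finf _] ei small.
suff /choice[phi phiP] A : exists t, F A -> 0 <= t < pi / 2 /\
    forall m, commutant_limit m A t -> ~ le (e m) (j A) by exists phi.
have [FA|nFA] := pselect (F A); last by exists 0.
apply: contrapT => none; apply: (small (j A)).
have [f fi f_itv] := real_inj_quarter R.
have /choice[m mP] x : exists m, commutant_limit m A (f x) /\ le (e m) (j A).
  apply: contrapT => nm; apply: none; exists (f x) => _; split=> // m mA mle.
  by apply: nm; exists m.
apply: (@word_large_inj R _ (e \o m)) => [x y /ei mxy|x]; last by have [] := mP x.
apply: fi; have [mx _] := mP x; have [my _] := mP y; rewrite -mxy in my.
exact: commutant_limit_inj (Finf _ FA) _ _ mx my.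
Qed.

Theorem theorem6p3 (R : realType) (F : set (set nat))
    (F_ad : almost_disjoint F) (F_card : F #= [set: R]) :
  exists phi : set nat -> R,
    [/\ forall A, F A -> 0 <= phi A < 2 * pi,
        has_density (AD F phi) [set: R]
      & forall B : set (mseq R),
          cstar_subalgebra B -> B `<=` AD F phi -> commutative_set B ->
          ~ has_density B [set: R]].
Proof.
have [j ji] : exists j : set nat -> R, {in F &, injective j}.
  move: F_card; rewrite card_eq_le => /andP[/pcard_leTP[j] _].
  by exists j; exact: inj.
have [e ei] := mseq_inj_real R.
have [le [le_total small]] := word_large_segments (@real_words_small R).
have [phi phiP] := diagonal_angles j F_ad ei small.
exists phi; split.
- move=> A /phiP[/andP[p0 p2] _]; rewrite p0 (lt_le_trans p2)//.
  by have := pi_ge0 R; lra.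
- exact: AD_density.
move=> B _ BAD Bcomm [_ Bdense].
have BV : B `<=` AD_like F phi := subset_trans BAD (AD_sub_like F_ad).
have [m mP] := commutative_commutant_limit Bcomm.
(* For [A] outside [G], totality puts [m] before [A], so [phi A] avoids [m] and [B] is null on [A].
   The members in [G] have codes in the small segment of [e m]. *)
pose G := [set A | le (j A) (e m)].
apply: (small (e m)); apply: word_largeS (density_word_large (G := G) ji BV _ Bdense).
  by move=> _ [A [_ GA] <-].
move=> u Bu A FA nGA; apply: contrapT => u_freq.
have [_ um _] := BV _ Bu; have [_ /(_ m)] := phiP A FA.
have mA := mP A (phi A) u Bu (um A FA) u_freq.
by move=> /(_ mA) nle; case: (le_total (j A) (e m)) => [/nGA|/nle].
Qed.
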